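(* For $2\le m<\infty$ and $0\le n\le\infty$, let $S:=\mathbb{F}_m^+\times\mathbb{N}^n$, where $\mathbb{F}_m^+$ is the free monoid in $m$ generators and $\mathbb{N}^n$ is the free abelian monoid in $n$ generators. The right LCM semigroup $S$ has the following properties: (i) $S$ is admissible with $\beta_c=1$. (ii) The action $\alpha$ is faithful if and only if $\alpha$ is almost free if and only if $n=0$. (iii) $S$ has finite propagation.
   Context: All semigroups are countable discrete monoids; $\mathbb{N}^\times$ is the multiplicative monoid of positive integers. **Right LCM semigroups.** A monoid $S$ is right LCM if it is left cancellative and for all $s,t\in S$ the set $sS\cap tS$ is empty or of the form $rS$; such $r$ is a right LCM of $s,t$. $S^*$ is the group of invertible elements. $S_c=\{a\in S: aS\cap sS\ne\emptyset\ \forall s\in S\}$. $S_{ci}$ is the set of $s\in S\setminus S_c$ such that every factorisation $s=ta$ with $a\in S_c$ forces $a\in S^*$; $S_{ci}^1=S_{ci}\cup\{1\}$. $s\sim t$ means $sa=tb$ for some $a,b\in S_c$; $[s]$ is the class of $s$. A transversal for $A/_\sim$, $A\subset S$, is a subset of $A$ that is a minimal complete set of representatives. A finite $F\subset S$ is a foundation set if every $s\in S$ satisfies $sS\cap fS\neq\emptyset$ for some $f\in F$; it is accurate if $fS\cap f'S=\emptyset$ for distinct $f,f'\in F$. **Admissibility.** For a submonoid $M$ of $\mathbb{N}^\times$, $\mathrm{Irr}(M)$ is the set of $m'\in M$, $m'\ne1$, such that $m'=kl$ with $k,l\in M$ implies $k=1$ or $l=1$. $S$ is admissible if: (A1) $S=S_{ci}^1S_c$;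 (A2) any right LCM of two elements of $S_{ci}$ belongs to $S_{ci}$; (A3) there is a nontrivial monoid homomorphism $N\colon S\to\mathbb{N}^\times$ (a generalised scale) such that (a) $|N^{-1}(k)/_\sim|=k$ for all $k\in N(S)$ and (b) for each $k\in N(S)$ every transversal of $N^{-1}(k)/_\sim$ is an accurate foundation set for $S$; (A4) $N(S)$ is the free abelian monoid in $\mathrm{Irr}(N(S))$. The critical inverse temperature $\beta_c$ is the smallest value such that $\zeta_S(\beta)=\sum_{k\in N(S)}k^{-(\beta-1)}$ is finite for all real $\beta>\beta_c$. Here the generalised scale on $S=\mathbb{F}_m^+\times\mathbb{N}^n$ is $N(w,x)=m^{\ell(w)}$, with $\ell(w)$ the word length. **The action $\alpha$.** $\alpha\colon S_c\curvearrowright S/_\sim$, $\alpha_a([s])=[as]$. It is faithful if for all $a\neq b$ in $S_c$ there is $x$ with $\alpha_a(x)\neq\alpha_b(x)$, and almost free if $\{x\in S/_\sim:\alpha_a(x)=\alpha_b(x)\}$ is finite for all $a\ne b$ in $S_c$. **Finite propagation.** For an admissible $S$ and a transversal $\mathcal{T}$ for $S/_\sim$ with $\mathcal{T}\subset S_{ci}^1$, each $s\in S$ is uniquely $s=i(s)c(s)$ with $i(s)\in\mathcal{T}$, $c(s)\in S_c$; put $C_a=\{c(af):f\in\mathcal{T}\}$. $S$ has finite propagation if for every $(a,b)\in S_c\times S_c$ there is such a $\mathcal{T}$ for which $C_a$ and $C_b$ are finite. *)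

(* Defs.v *)
From HB Require Import structures.
From mathcomp Require Import -(notations) monalg.
From mathcomp Require Import all_boot all_order all_algebra finmap.
From mathcomp Require Import all_classical all_reals all_analysis.

Set Implicit Arguments.
Unset Strict Implicit.
Unset Printing Implicit Defensive.

Local Open Scope classical_set_scope.
Local Open Scope card_scope.
Local Open Scope group_scope.

Section RightLCM.
Variable S : monoidType.
Implicit Types (s t r a b : S) (A T F X : set S).

Definition rideal s : set S := range (fun x : S => s * x).

Definition is_right_lcm s t r : Prop := rideal s `&` rideal t = rideal r.

Definition right_lcm : Prop :=
  (forall a, injective (fun x : S => a * x)) /\
  (forall s t, rideal s `&` rideal t = set0 \/ exists r, is_right_lcm s t r).

Definition invertible : set S := [set x | exists y : S, x * y = 1 /\ y * x = 1].

(* S_c *)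
Definition core : set S := [set a | forall s, rideal a `&` rideal s !=set0].

(* S_ci and S_ci^1 *)
Definition core_irr : set S :=
  [set s | ~ core s /\ forall t a, core a -> s = t * a -> invertible a].

Definition core_irr1 : set S := core_irr `|` [set 1].

Definition core_equiv s t : Prop :=
  exists a b, [/\ core a, core b & s * a = t * b].

(* Elements of S/~ are represented by the corresponding subsets of S. *)
Definition core_class s : set S := [set t | core_equiv s t].

Definition quotient A : set (set S) := core_class @` A.

Definition complete_reps A T : Prop :=
  T `<=` A /\ forall s, A s -> exists2 t, T t & core_equiv s t.

Definition transversal A T : Prop :=
  complete_reps A T /\
  forall T', complete_reps A T' -> T' `<=` T -> T' = T.

Definition foundation_set F : Prop :=
  finite_set F /\
  forall s, exists2 f, F f & rideal s `&` rideal f !=set0.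

Definition accurate F : Prop :=
  forall f f', F f -> F f' -> f <> f' -> rideal f `&` rideal f' = set0.

(* alpha_a, acting on classes: on [s] its value is [a * s], see
   [core_act_class]. *)
Definition core_act a X : set S := \bigcup_(s in X) core_class (a * s).

Definition action_faithful : Prop :=
  forall a b, core a -> core b -> a <> b ->
    exists2 x, quotient [set: S] x & core_act a x <> core_act b x.

Definition action_almost_free : Prop :=
  forall a b, core a -> core b -> a <> b ->
    finite_set [set x | quotient [set: S] x /\ core_act a x = core_act b x].

(* [is_core_part T s c] says that s = i(s) c(s) with c(s) = c; this determines
   c, see [core_part_unique]. *)
Definition is_core_part T s (c : S) : Prop :=
  core c /\ exists2 i, T i & s = i * c.

(* C_a *)
Definition core_parts T a : set S :=
  [set c | exists2 f, T f & is_core_part T (a * f) c].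

Definition finite_propagation : Prop :=
  forall a b, core a -> core b ->
    exists T, [/\ transversal [set: S] T, T `<=` core_irr1,
                  finite_set (core_parts T a) & finite_set (core_parts T b)].

End RightLCM.

Definition irr (M : set nat) : set nat :=
  [set p | [/\ M p, p <> 1%N &
    forall k l, M k -> M l -> p = (k * l)%N -> k = 1%N \/ l = 1%N]].

(* The monoid homomorphism from the free abelian monoid on X to the
   multiplicative monoid of integers, extending the inclusion of X, is a
   bijection onto M. [cmonom nat] is the free abelian monoid on nat. *)
Definition free_abelian_in (M X : set nat) : Prop :=
  set_bij [set x : cmonom nat | forall p : nat, p \in finsupp x -> X p] M
    (fun x : cmonom nat => \prod_(p <- finsupp x) p ^ x p)%N.

Section Admissible.
Variable S : monoidType.
Implicit Type N : S -> nat.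

Definition nontrivial_hom N : Prop :=
  [/\ forall s, (0 < N s)%N, N 1 = 1%N,
      forall s t, N (s * t) = (N s * N t)%N & exists s, N s <> 1%N].

Definition generalised_scale N : Prop :=
  [/\ nontrivial_hom N,
      forall k, range N k -> quotient (N @^-1` [set k]) #= `I_k &
      forall k, range N k -> forall T, transversal (N @^-1` [set k]) T ->
        foundation_set T /\ accurate T].

Definition admissible_with N : Prop :=
  [/\ forall s : S, exists t a, [/\ core_irr1 t, core a & s = t * a],
      forall s t r : S, core_irr s -> core_irr t -> is_right_lcm s t r ->
        core_irr r,
      generalised_scale N &
      free_abelian_in (range N) (irr (range N))].

Definition zeta (R : realType) N (beta : R) : \bar R :=
  (\esum_(k in range N) (k%:R `^ (- (beta - 1)))%:E)%R.

Definition zeta_finite_above (R : realType) N (b : \bar R) : Prop :=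
  forall beta : R, (b < beta%:E)%E -> (zeta N beta < +oo)%E.

Definition critical_inverse_temperature (R : realType) N (bc : \bar R) : Prop :=
  zeta_finite_above N bc /\
  forall b : \bar R, zeta_finite_above N b -> (bc <= b)%E.

End Admissible.

Section FreeMonoids.
Variable I : choiceType.

HB.instance Definition _ := isMonoid.Build (fmonom I)
  (@monalg.mulmA (fmonom I)) (@monalg.mul1m (fmonom I))
  (@monalg.mulm1 (fmonom I)).

HB.instance Definition _ := isMonoid.Build (cmonom I)
  (@monalg.mulmA (cmonom I)) (@monalg.mul1m (cmonom I))
  (@monalg.mulm1 (cmonom I)).

End FreeMonoids.

(* The value n = oo is encoded as None. *)
Definition generators (n : option nat) : choiceType :=
  if n is Some k then 'I_k else nat.

Definition FreeTimesAbelian (m : nat) (n : option nat) : monoidType :=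
  (fmonom 'I_m * cmonom (generators n))%type.

Definition length_scale (m : nat) (n : option nat)
  (s : FreeTimesAbelian m n) : nat := (m ^ fdeg s.1)%N.

Section Sanity.
Variable S : monoidType.
Hypothesis SR : right_lcm S.
Implicit Types (s t r a b c : S).

Lemma coreM a b : core a -> core b -> core (a * b).
Proof.
move=> ca cb s; have [_ [[x _ <-] [y _ yE]]] := ca s.
have [_ [[p _ <-] [q _ qE]]] := cb x.
exists (a * b * p); split; first by exists p.
by exists (y * q) => //; rewrite mulgA yE -mulgA qE mulgA.
Qed.

Lemma core1 : core (1 : S).
Proof.
by move=> s; exists s; split; [exists s; rewrite ?mul1g|exists 1; rewrite ?mulg1].
Qed.

Lemma core_common b c : core b -> core c ->
  exists b' c', [/\ core b', core c' & b * b' = c * c'].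
Proof.
wlog suff half : b c / core b -> core c -> forall r b',
    is_right_lcm b c r -> r = b * b' -> core b'.
  move=> cb cc; have [H|[r rE]] := (SR.2 b c).
    by have := cb c; rewrite H => -[? []].
  have [[b' _ bE] [c' _ cE]] : (rideal b `&` rideal c) r.
    by rewrite rE; exists 1; rewrite ?mulg1.
  exists b', c'; split; last by rewrite bE cE.
    exact: (half b c cb cc r).
  by apply: (half c b cc cb r) => //; rewrite /is_right_lcm setIC.
move=> cb cc r b' rE rb s; have [_ [[x _ <-] [y _ yE]]] := cc (b * s).
have : (rideal b `&` rideal c) (c * x).
  by split; [exists (s * y) => //; rewrite mulgA|exists x].
rewrite rE => -[z _ zE]; exists (b' * z); split; first by exists z.
by exists y => //; apply: (SR.1 b); rewrite /= mulgA yE -zE rb mulgA.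
Qed.

Lemma core_equiv_refl s : core_equiv s s.
Proof. by exists 1, 1; split=> //; exact: core1. Qed.

Lemma core_equiv_sym s t : core_equiv s t -> core_equiv t s.
Proof. by move=> [a [b [ca cb E]]]; exists b, a. Qed.

Lemma core_equiv_trans t s r :
  core_equiv s t -> core_equiv t r -> core_equiv s r.
Proof.
move=> [a [b [ca cb sE]]] [c [d [cc cd tE]]].
have [b' [c' [cb' cc' E]]] := core_common cb cc.
exists (a * b'), (d * c'); split; try exact: coreM.
by rewrite mulgA sE -mulgA E mulgA tE mulgA.
Qed.

Lemma core_equivMl a s t : core_equiv s t -> core_equiv (a * s) (a * t).
Proof. by move=> [b [c [cb cc E]]]; exists b, c; rewrite -!mulgA E. Qed.

Lemma core_act_class a s : core_act a (core_class s) = core_class (a * s).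
Proof.
apply/seteqP; split=> [x [t st xE]|x xE].
  exact: core_equiv_trans (core_equivMl a st) xE.
by exists s => //; exact: core_equiv_refl.
Qed.

Lemma transversal_inj (A T : set S) i j : transversal A T -> T i -> T j ->
  core_equiv i j -> i = j.
Proof.
move=> [[TA Tc] Tm] Ti Tj ij; apply: contrapT => nij.
suff E : T `\ j = T.
  have [_ njj] : (T `\ j) j by rewrite E.
  exact: njj.
apply: Tm; last by move=> x [].
split=> [x [/TA//]|s /Tc [t Tt st]].
have [tj|tj] := pselect (t = j); last by exists t.
exists i; first by split.
by apply: core_equiv_trans st _; rewrite tj; exact: core_equiv_sym.
Qed.

Lemma core_part_unique (T : set S) s c c' : transversal [set: S] T ->
  is_core_part T s c -> is_core_part T s c' -> c = c'.
Proof.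
move=> TT [cc [i Ti sE]] [cc' [j Tj sE']].
have ij : i = j by apply: (transversal_inj TT Ti Tj); exists c, c'; rewrite -sE -sE'.
by apply: (SR.1 i); rewrite /= -sE sE' ij.
Qed.

End Sanity.

(* Main.v *)
Require Import Defs.
From mathcomp Require Import -(notations) monalg.
From mathcomp Require Import all_boot all_order all_algebra finmap.
From mathcomp Require Import all_classical all_reals all_analysis.
(* Restores the names [transversal] and [quotient] of the semigroup theory,
   hidden by their homonyms on finite sets and finite groups. *)
Import Defs.

(** An element of S is a word w together with an exponent vector x. Everything
    rests on one description of divisibility ([ridealP]): s divides r on the
    left exactly when the word of s is a prefix of the word of r and the
    exponents of s are bounded by those of r. Two prefixes of one word are
    comparable, and exponent vectors always have a supremum, so two principal
    right ideals meet exactly when the words are comparable ([rideals_meet]),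
    and then their intersection is again principal ([right_lcm_sup]).

    With two distinct letters available, no nonempty word is comparable to all
    words, so the core is the abelian factor ([coreP]), s ~ t means that s and t
    have the same word ([core_equivP]), and the core irreducible elements are
    the nonempty words with zero exponents ([core_irrP]). Hence the classes of
    N^-1(m^l) are the m^l words of length l. A transversal contains exactly one
    element over each such word; every word is comparable to a word of length l,
    and two distinct words of length l are incomparable, so a transversal is an
    accurate foundation set ([transversal_words]). The image of N consists of
    the powers of m, which is free abelian on m ([free_abelian_powers]), and
    zeta is the geometric series of ratio m^-(beta-1), which converges exactly
    for beta > 1 ([critical_powers]).

    The core multiplies only the exponents, which ~ forgets. Thus it acts
    trivially on the infinite set S/~, and the action is faithful, or almost
    free, only if the core has a single element, that is n = 0; conversely, both
    properties are vacuous for a one-element core. For finite propagation, take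
    the transversal of all elements with zero exponents: a core element a
    commutes past the words, so that C_a = {a}. *)

Set Implicit Arguments.
Unset Strict Implicit.
Unset Printing Implicit Defensive.

Local Open Scope classical_set_scope.
Local Open Scope group_scope.

(** * Divisibility in the product of a free and a free abelian monoid *)

Section Structure.
Variables (m : nat) (n : option nat).
Local Notation S := (FreeTimesAbelian m n).
Implicit Types (s t r a b : S) (w u v : seq 'I_m) (x y : cmonom (generators n)).
Implicit Types (A T : set S).

Definition word s : seq 'I_m := s.1.
Definition exponent s (i : generators n) : nat := s.2 i.
Definition elt w x : S := (FMonom w, x).

Lemma elt_word w x : word (elt w x) = w. Proof. by []. Qed.

Lemma wordM s t : word (s * t) = word s ++ word t.
Proof. exact: fmM. Qed.

Lemma word1 : word 1 = [::].
Proof. exact: fm1. Qed.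

Lemma exponentM s t i : exponent (s * t) i = (exponent s i + exponent t i)%N.
Proof. exact: cmM. Qed.

Lemma exponent1 i : exponent 1 i = 0%N.
Proof. exact: cm1. Qed.

Lemma elt_eq s t : word s = word t -> exponent s =1 exponent t -> s = t.
Proof.
case: s t => [[w] x] [[v] y] /= vw xy.
have -> : x = y by apply/eqP/cmP.
by move: vw; rewrite /word /= => ->.
Qed.

Lemma elt_split s : s = elt (word s) 1 * elt [::] s.2.
Proof.
by apply: elt_eq => [|i]; rewrite ?wordM ?cats0 // exponentM /exponent /= cm1.
Qed.

Lemma ridealP s r :
  rideal s r <->
  prefix (word s) (word r) /\ forall i, (exponent s i <= exponent r i)%N.
Proof.
split=> [[t _ <-]|[/prefixP [w rE] le_sr]].
  by rewrite wordM prefix_prefix; split=> // i; rewrite exponentM leq_addr.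
exists (elt w (divcm r.2 s.2)) => //; apply: elt_eq; first by rewrite wordM rE.
by move=> i; rewrite exponentM /exponent divcmE subnKC //; exact: le_sr.
Qed.

Lemma left_cancel a : injective (fun s => a * s).
Proof.
move=> s t /= E; apply: elt_eq.
  have /eqP := congr1 word E.
  by rewrite !wordM eqseq_cat // eqxx => /eqP.
by move=> i; have := congr1 (exponent^~ i) E; rewrite /= !exponentM => /addnI.
Qed.

(** The pointwise maximum, as x * (y / x): the truncated quotient y / x is
    exactly what x lacks. *)
Definition supcm x y : cmonom (generators n) := mulcm x (divcm y x).

Lemma supcmE x y i : supcm x y i = maxn (x i) (y i).
Proof. by rewrite mulcmE divcmE maxnE. Qed.

Lemma prefixes_comparable w v u :
  prefix w u -> prefix v u -> prefix w v || prefix v w.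
Proof.
wlog: w v / (size w <= size v)%N => [H|le_wv].
  case: (leqP (size w) (size v)) => [|/ltnW] wv; first exact: H.
  by rewrite orbC => ? ?; exact: H.
rewrite !prefixE => /eqP wE /eqP vE.
by rewrite -vE take_takel // wE eqxx.
Qed.

(** Both ideals ask for a prefix and for bounds on the exponents: the longer
    prefix implies the shorter one, and the two bounds amount to a bound by the
    maximum. *)
Lemma right_lcm_sup s t : prefix (word s) (word t) ->
  is_right_lcm s t (elt (word t) (supcm s.2 t.2)).
Proof.
move=> st; apply/seteqP; split=> r.
  move=> [/ridealP [_ sr] /ridealP [tr tr']]; apply/ridealP; split=> // i.
  by rewrite /exponent /= supcmE geq_max sr tr'.
move=> /ridealP [tr xr]; split; apply/ridealP.
  split=> [|i]; first exact: prefix_trans st tr.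
  by apply: leq_trans (xr i); rewrite /exponent /= supcmE leq_maxl.
split=> // i.
by apply: leq_trans (xr i); rewrite /exponent /= supcmE leq_maxr.
Qed.

Lemma rideals_meet s t : rideal s `&` rideal t !=set0 <->
  prefix (word s) (word t) || prefix (word t) (word s).
Proof.
split=> [[r [/ridealP [sr _] /ridealP [tr _]]]|/orP [] /right_lcm_sup].
- exact: prefixes_comparable sr tr.
- by move=> ->; eexists; exists 1; rewrite ?mulg1.
by rewrite /is_right_lcm setIC => ->; eexists; exists 1; rewrite ?mulg1.
Qed.

Lemma right_lcm_free_times_abelian : right_lcm S.
Proof.
split=> [|s t]; first exact: left_cancel.
have [->|/set0P/rideals_meet/orP [st|ts]] :=
  eqVneq (rideal s `&` rideal t) set0.
- by left.
- by right; eexists; exact: right_lcm_sup.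
by right; eexists; rewrite /is_right_lcm setIC; exact: right_lcm_sup.
Qed.

(** * Core, equivalence and core irreducible elements *)

Hypothesis m_ge2 : (2 <= m)%N.

(** A word starting with the letter i is incomparable to the one-letter word j,
    for any other letter j; the empty word is comparable to everything. *)
Lemma coreP a : core a <-> word a = [::].
Proof.
split=> [ca|a1 s]; last by apply/rideals_meet; rewrite a1 prefix0s.
case aE: (word a) => [//|i w].
have [j ji] : exists j : 'I_m, j != i.
  pose j0 := Ordinal (ltnW m_ge2); pose j1 := Ordinal m_ge2.
  have [i0|] := eqVneq j0 i; last by exists j0.
  by exists j1; rewrite -i0.
have /rideals_meet := ca (elt [:: j] 1).
by rewrite aE /= ![_ == i]eq_sym eq_sym (negPf ji).
Qed.

(** Core factors do not touch the word; conversely, multiplying each of two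
    elements by the exponents of the other makes them equal if their words
    agree. *)
Lemma core_equivP s t : core_equiv s t <-> word s = word t.
Proof.
split=> [[a [b [/coreP a1 /coreP b1 E]]]|st].
  by have := congr1 word E; rewrite !wordM a1 b1 !cats0.
exists (elt [::] t.2), (elt [::] s.2); split; try exact/coreP.
apply: elt_eq => [|i]; first by rewrite !wordM st.
by rewrite !exponentM addnC.
Qed.

Lemma core_class_eq s t : core_class s = core_class t <-> word s = word t.
Proof.
split=> [E|st].
  have : core_class t t by exact/core_equivP.
  by rewrite -E => /core_equivP.
by apply/seteqP; split=> r /core_equivP rE; apply/core_equivP; rewrite -rE st.
Qed.

Lemma invertibleP s : invertible s -> s = 1.
Proof.
move=> [t [st _]]; apply: elt_eq => [|i].
  have := congr1 word st; rewrite wordM word1.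
  by case: (word s).
have := congr1 (exponent^~ i) st; rewrite /= exponentM exponent1 => /eqP.
by rewrite addn_eq0 => /andP [/eqP].
Qed.

(** The exponent vector of s is always a core factor of s ([elt_split]), hence
    it is invertible, that is trivial, when s is core irreducible. *)
Lemma core_irrP s :
  core_irr s <-> word s <> [::] /\ forall i, exponent s i = 0%N.
Proof.
split=> [[/coreP s1 irr_s]|[s1 s0]].
  split=> // i.
  have /invertibleP E : invertible (elt [::] s.2).
    apply: (irr_s (elt (word s) 1)); first exact/coreP.
    exact: elt_split.
  by have := congr1 (exponent^~ i) E; rewrite /= exponent1.
split=> [/coreP//|t a /coreP a1 E].
have -> : a = 1; last by exists 1; rewrite mulg1.
apply: elt_eq => [|i]; first by rewrite word1.
have := s0 i; rewrite E exponentM exponent1 => /eqP.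
by rewrite addn_eq0 => /andP [_ /eqP].
Qed.

Lemma core_irr1_elt w : core_irr1 (elt w 1).
Proof.
case: w => [|i w].
  by right; apply: elt_eq => [|j]; rewrite ?word1 ?exponent1 // /exponent cm1.
by left; apply/core_irrP; split=> // j; exact: cm1.
Qed.

(** Right LCMs are only determined up to an invertible factor, so r is compared
    with the explicit common multiple t: the ideal of r contains t, which bounds
    the exponents of r by 0. *)
Lemma core_irr_lcm s t r :
  core_irr s -> core_irr t -> is_right_lcm s t r -> core_irr r.
Proof.
wlog st : s t / prefix (word s) (word t) => [H cs ct rE|].
  have /rideals_meet/orP[st|ts] : rideal s `&` rideal t !=set0.
  - by rewrite rE; exists r, 1; rewrite ?mulg1.
  - exact: (H s t).
  by apply: (H t s) => //; rewrite /is_right_lcm setIC.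
move=> /core_irrP [s1 s0] /core_irrP [t1 t0] rE.
have /ridealP [rt r0] : rideal r t.
  by rewrite -rE; split; apply/ridealP; split=> // *; rewrite ?s0 ?prefix_refl.
have [/ridealP [sr _] _] : (rideal s `&` rideal t) r.
  by rewrite rE; exists 1; rewrite ?mulg1.
apply/core_irrP; split=> [r1|i].
  by move: sr; rewrite r1 prefixs0 => /eqP.
by apply/eqP; rewrite -leqn0 -(t0 i) r0.
Qed.

(** * The generalised scale *)

Lemma card_setT_finType (T : finType) : ([set: T] #= `I_#|T|)%card.
Proof.
have -> : `I_#|T| = range (fun x : T => enum_rank x : nat).
  apply/seteqP; split=> k /=; last by move=> [x _ <-].
  by move=> kT; exists (enum_val (Ordinal kT)); rewrite ?enum_valK.
by rewrite card_eq_sym; apply: inj_card_eq => x y _ _ /val_inj/enum_rank_inj.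
Qed.

Lemma length_scaleE s : length_scale s = (m ^ size (word s))%N.
Proof. by []. Qed.

Lemma range_length_scale :
  range (@length_scale m n) = range (fun l : nat => m ^ l)%N.
Proof.
apply/seteqP; split=> k [].
  by move=> s _ <-; exists (size (word s)).
move=> l _ <-; exists (elt (nseq l (Ordinal (ltnW m_ge2))) 1) => //.
by rewrite length_scaleE elt_word size_nseq.
Qed.

Lemma length_scale_fiber l :
  @length_scale m n @^-1` [set (m ^ l)%N] = [set s | size (word s) = l].
Proof.
apply/seteqP; split=> s /=; rewrite length_scaleE; last by move=> ->.
by move=> /(expnI m_ge2).
Qed.

Lemma card_quotient_fiber l :
  (quotient [set s | size (word s) = l] #= `I_(m ^ l))%card.
Proof.
pose f (w : l.-tuple 'I_m) : set S := core_class (elt w 1).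
have -> : quotient [set s | size (word s) = l] = range f.
  apply/seteqP; split=> X [].
    move=> s /= sl <-; have sl' : size (word s) == l by apply/eqP.
    by exists (Tuple sl') => //; apply/core_class_eq.
  by move=> w _ <-; exists (elt w 1) => //=; rewrite elt_word size_tuple.
have card_word : (range f #= [set: l.-tuple 'I_m])%card.
  by apply: inj_card_eq => w v _ _ /core_class_eq wv; exact: val_inj.
rewrite (card_eql card_word) -[in X in `I_X](card_ord m) -card_tuple.
exact: card_setT_finType.
Qed.

(** For the foundation property, pad the word of s with l letters and truncate
    the result to length l: both this word of length l and the word of s are
    prefixes of the padded word, hence comparable. *)
Lemma transversal_words l T : transversal [set s | size (word s) = l] T ->
  foundation_set T /\ accurate T.
Proof.
move=> TT; have [[TA Tc] _] := TT.
have word_inj f f' : T f -> T f' -> word f = word f' -> f = f'.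
  move=> Tf Tf' /core_equivP.
  exact: (transversal_inj right_lcm_free_times_abelian TT).
split; last first.
  move=> f f' Tf Tf' ff'; apply/eqP; apply: contrapT.
  move=> /negP/set0P/rideals_meet H.
  apply: ff'; apply: word_inj => //; move: H (TA _ Tf) (TA _ Tf') => /=.
  case/orP=> /prefixP [v ->]; rewrite size_cat => E1 E2.
    have/size0nil -> : size v = 0%N by apply/(@addnI l); rewrite addn0 -{1}E1.
    by rewrite cats0.
  have/size0nil -> : size v = 0%N by apply/(@addnI l); rewrite addn0 -{1}E2.
  by rewrite cats0.
split.
  have : finite_set (word @` T).
    apply: (@sub_finite_set _ _ (range (@tval l 'I_m))).
      move=> w [f /TA fl <-]; exists (tcast fl (in_tuple (word f))) => //.
      by rewrite val_tcast.
    exact: finite_image.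
  rewrite (eq_finite_set (inj_card_eq _)) // => f f' /set_mem Tf /set_mem Tf'.
  exact: word_inj.
move=> s; pose u := word s ++ nseq l (Ordinal (ltnW m_ge2)).
have ul : size (take l u) = l.
  by apply: size_takel; rewrite size_cat size_nseq leq_addl.
have [f Tf /core_equivP E] := Tc (elt (take l u) 1) ul.
exists f => //; apply/rideals_meet; rewrite -E elt_word.
apply: (@prefixes_comparable _ _ u); first exact: prefix_prefix.
exact: prefix_take.
Qed.

End Structure.

(** * The monoid of powers of m *)

Section Scale.
Variable m : nat.
Hypothesis m_ge2 : (2 <= m)%N.

Lemma irr_powers : irr (range (fun l : nat => m ^ l)%N) = [set m].
Proof.
apply/seteqP; split=> p; last first.
  move=> ->; split; first by exists 1%N; rewrite ?expn1.
    by move=> m1; have := m_ge2; rewrite m1.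
  move=> _ _ [k _ <-] [l _ <-]; rewrite -{1}[m]expn1 -expnD => /(expnI m_ge2).
  by case: k l => [|[|k]] [|l] //; rewrite ?expn0; tauto.
move=> [[[|l] _ <-] p1 irr_p]; first by case: p1.
have [||m1|l1] := irr_p m (m ^ l)%N _ _ (expnS m l).
- by exists 1%N; rewrite ?expn1.
- by exists l.
- by have := m_ge2; rewrite m1.
by rewrite expnS l1 muln1.
Qed.

(** A monomial supported in {m} is determined by its exponent at m. *)
Lemma free_abelian_powers :
  free_abelian_in (range (fun l : nat => m ^ l)%N) [set m].
Proof.
have prodE (x : cmonom nat) : (forall p : nat, p \in finsupp x -> p = m) ->
    (\prod_(p <- finsupp x) p ^ x p = m ^ x m)%N.
  move=> xm; rewrite (@big_fset_incl _ _ _ _ _ [fset m]%fset) /=.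
  - by rewrite big_seq_fset1.
  - by apply/fsubsetP => p /xm ->; rewrite in_fset1.
  by move=> p _; rewrite memNfinsupp => /eqP ->.
split.
- by move=> x /= xm; exists (x m); rewrite ?prodE.
- move=> x y /set_mem /= xm /set_mem /= ym.
  rewrite !prodE // => /(expnI m_ge2) xy.
  apply/eqP/cmP => p; have [->//|pm] := eqVneq p m.
  have out (z : cmonom nat) :
      (forall p : nat, p \in finsupp z -> p = m) -> z p = 0%N.
    move=> zm; apply/eqP; rewrite cmE_eq0; apply: contra pm => /zm ->.
    exact: eqxx.
  by rewrite !out.
move=> _ [l _ <-].
pose x : cmonom nat := mkcmonom [fsfun i in [fset m]%fset => l | 0%N].
have xE p : x p = if p == m then l else 0%N.
  by rewrite /x cmE fsfun_fun in_fset1.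
have xm (p : nat) : p \in finsupp x -> p = m.
  by rewrite -cmE_neq0 xE; case: (p =P m).
by exists x => //=; rewrite prodE // xE eqxx.
Qed.

End Scale.

(** * The critical inverse temperature *)

Section Zeta.
Variable (R : realType).
Import Order.TTheory GRing.Theory Num.Theory numFieldNormedType.Exports.
Local Open Scope ring_scope.
Local Open Scope ereal_scope.

Lemma esum_geometric_lty (z : R) : (0 < z < 1)%R ->
  \esum_(l in [set: nat]) (z ^+ l)%:E < +oo.
Proof.
move=> /andP [z0 z1].
rewrite -nneseries_esumT; last by move=> l; rewrite lee_fin exprn_ge0 // ltW.
apply: (@le_lt_trans _ _ ((1 / (1 - z))%:E)); last exact: ltry.
apply: lime_le.
  by apply: is_cvg_nneseries => l _ _; rewrite lee_fin exprn_ge0 // ltW.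
apply: nearW => k; rewrite sumEFin lee_fin.
rewrite (_ : (\sum_(_ <= _ < _) _)%R = series (geometric 1%R z) k).
  by apply: geometric_le_lim => //; rewrite gtr0_norm.
by apply: eq_bigr => l _ /=; rewrite mul1r.
Qed.

Lemma esum_one_infinite (T : choiceType) (A : set T) : infinite_set A ->
  \esum_(k in A) (1 : \bar R) = +oo.
Proof.
move=> A_inf; apply/eqyP => M _.
have [F FA cF] := infinite_set_fset (Num.truncn M).+1 A_inf.
apply: esum_ge; exists [set` F]; first by split.
rewrite fsbig_finite //= set_fsetK sumEFin lee_fin.
rewrite big_const_seq count_predT iter_addr_0.
by apply: (le_trans (ltW (truncnS_gt M))); rewrite ler_nat.
Qed.

Lemma zeta_powers (S : monoidType) (N : S -> nat) (m : nat) (beta : R) :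
  (2 <= m)%N -> range N = range (fun l : nat => m ^ l)%N ->
  zeta N beta = \esum_(l in [set: nat]) ((m%:R `^ (- (beta - 1))) ^+ l)%:E.
Proof.
move=> m_ge2 NE; rewrite /zeta NE esum_image; last first.
  by move=> k l _ _; exact: expnI.
apply: eq_esum => l _.
by rewrite natrX -!powR_mulrn ?powR_ge0 // -!powRrM mulrC.
Qed.

(** For beta > 1 the ratio m^-(beta-1) lies strictly between 0 and 1. At
    beta = 1 the series is an infinite sum of ones, so no bound below 1 is
    possible. *)
Lemma critical_powers (S : monoidType) (N : S -> nat) (m : nat) :
  (2 <= m)%N -> range N = range (fun l : nat => m ^ l)%N ->
  critical_inverse_temperature N (1%:E : \bar R).
Proof.
move=> m_ge2 NE; split=> [beta|b fin_b].
  rewrite lte_fin => beta1; rewrite (zeta_powers _ m_ge2) //.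
  apply: esum_geometric_lty; rewrite powR_gt0 ?ltr0n ?(ltnW m_ge2) //=.
  rewrite lt_neqAle powR_eq1 oppr_eq0 subr_eq0 (gt_eqF beta1) ltrn0 pnatr_eq1.
  rewrite (gtn_eqF m_ge2) /= -[leRHS](powRr0 (m%:R : R)) ler_powR //.
    by rewrite ler1n ltnW.
  by rewrite oppr_le0 subr_ge0 ltW.
rewrite leNgt; apply/negP => /fin_b; rewrite (zeta_powers _ m_ge2) //.
rewrite subrr oppr0 powRr0 (eq_esum (b := fun=> 1)) => [|l _].
  by rewrite esum_one_infinite ?ltxx //; exact: infinite_nat.
by rewrite expr1n.
Qed.

End Zeta.

(** * The action of the core, finite propagation and admissibility *)

Section Action.
Variables (m : nat) (n : option nat).
Hypothesis m_ge2 : (2 <= m)%N.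
Local Notation S := (FreeTimesAbelian m n).

(** Left multiplication by a core element does not change the word. *)
Lemma core_act_eq (a b s : S) : core a -> core b ->
  core_act a (core_class s) = core_act b (core_class s).
Proof.
have SR := @right_lcm_free_times_abelian m n.
move=> /(coreP m_ge2) a1 /(coreP m_ge2) b1; rewrite !(core_act_class SR).
by apply/(core_class_eq m_ge2); rewrite !wordM a1 b1.
Qed.

Lemma quotient_infinite : infinite_set (quotient [set: S]).
Proof.
pose f (l : nat) : set S := core_class (elt (nseq l (Ordinal (ltnW m_ge2))) 1).
apply: (@sub_infinite_set _ (range f)).
  by move=> _ [l _ <-]; apply: imageT.
rewrite (eq_finite_set (inj_card_eq _)); first exact: infinite_nat.
move=> k l _ _ /(core_class_eq m_ge2).
by move/(congr1 size); rewrite !elt_word !size_nseq.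
Qed.

Lemma core_trivial : n = Some 0%N -> forall a b : S, core a -> core b -> a = b.
Proof.
move=> n0 a b /(coreP m_ge2) a1 /(coreP m_ge2) b1.
apply: elt_eq => [|i]; first by rewrite a1.
have noI : generators (Some 0%N) -> False by case.
by case: noI; rewrite -n0.
Qed.

Lemma core_nontrivial : n <> Some 0%N ->
  exists a b : S, [/\ core a, core b & a <> b].
Proof.
move=> n0; have [i _] : exists i : generators n, True.
  by case: n n0 => [[//|k]|] _; [exists ord0|exists 0%N].
exists 1, (elt [::] (ucm i)); split; try exact/(coreP m_ge2).
  by apply/(coreP m_ge2); exact: word1.
move=> /(congr1 (fun s => exponent s i)).
by rewrite exponent1 /exponent /= cmUU.
Qed.

Lemma action_faithfulP : action_faithful S <-> n = Some 0%N.
Proof.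
split=> [faith|n0 a b ca cb ab]; last by case: ab; exact: core_trivial.
apply: contrapT => /core_nontrivial [a [b [ca cb ab]]].
have [_ [s _ <-]] := faith a b ca cb ab.
by case; exact: core_act_eq.
Qed.

Lemma action_almost_freeP : action_almost_free S <-> n = Some 0%N.
Proof.
split=> [free|n0 a b ca cb ab]; last by case: ab; exact: core_trivial.
apply: contrapT => /core_nontrivial [a [b [ca cb ab]]].
apply: quotient_infinite; apply: sub_finite_set (free a b ca cb ab).
by move=> _ [s _ <-]; split; [exists s|exact: core_act_eq].
Qed.

(** With the transversal of elements (w, 1), a core element a = (1, x) satisfies
    a(w, 1) = (w, 1)a, so that a is its own only core part. *)
Lemma finite_propagation_words : finite_propagation S.
Proof.
pose T : set S := range (fun w => elt w 1).
have TT : transversal [set: S] T.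
  split.
    split=> // s _; exists (elt (word s) 1); first by exists (word s).
    exact/(core_equivP m_ge2).
  move=> T' [_ T'c] T'T; apply/seteqP; split=> // _ [w _ <-].
  have [t T't /(core_equivP m_ge2)] := T'c (elt w 1) Logic.I.
  by have [v _ vt] := T'T _ T't; rewrite -vt !elt_word => ->; rewrite vt.
have parts (a : S) : core a -> finite_set (core_parts T a).
  move=> /(coreP m_ge2) a1; apply: (@sub_finite_set _ _ [set a]) => // c.
  move=> [_ [w _ <-] [/(coreP m_ge2) c1 [_ [v _ <-] E]]] /=.
  apply: elt_eq => [|i]; first by rewrite a1.
  have := congr1 (fun s => exponent s i) E.
  by rewrite !exponentM /exponent /= cm1 addn0 add0n => ->.
move=> a b ca cb; exists T; split=> //; try exact: parts.
by move=> _ [w _ <-]; exact: core_irr1_elt.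
Qed.

Lemma admissible_free_times_abelian : admissible_with (@length_scale m n).
Proof.
split.
- move=> s; exists (elt (word s) 1), (elt [::] s.2); split.
  + exact: core_irr1_elt.
  + exact/(coreP m_ge2).
  exact: elt_split.
- exact: core_irr_lcm.
- split.
  + split.
    * by move=> s; rewrite expn_gt0 (ltnW m_ge2).
    * by rewrite length_scaleE word1.
    * by move=> s t; rewrite !length_scaleE wordM size_cat expnD.
    exists (elt [:: Ordinal m_ge2] 1); rewrite length_scaleE expn1.
    by move=> m1; have := m_ge2; rewrite m1.
  + rewrite range_length_scale // => _ [l _ <-].
    by rewrite length_scale_fiber //; exact: card_quotient_fiber.
  rewrite range_length_scale // => _ [l _ <-] T; rewrite length_scale_fiber //.
  exact: transversal_words.
rewrite range_length_scale // irr_powers //; exact: free_abelian_powers.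
Qed.

End Action.

Theorem proposition5p7 (R : realType) (m : nat) (n : option nat) :
  (2 <= m)%N ->
  right_lcm (FreeTimesAbelian m n) /\
  (* (i) *)
  (admissible_with (@length_scale m n) /\
   critical_inverse_temperature (@length_scale m n) (1%:E : \bar R)) /\
  (* (ii) *)
  ((action_faithful (FreeTimesAbelian m n) <->
      action_almost_free (FreeTimesAbelian m n)) /\
   (action_almost_free (FreeTimesAbelian m n) <-> n = Some 0%N)) /\
  (* (iii) *)
  finite_propagation (FreeTimesAbelian m n).
Proof.
move=> m_ge2; split; first exact: right_lcm_free_times_abelian.
split; first split.
- exact: admissible_free_times_abelian.
- exact: (critical_powers R m_ge2 (range_length_scale n m_ge2)).
split; last exact: finite_propagation_words.
have free := @action_almost_freeP m n m_ge2.
by split=> //; rewrite free; exact: action_faithfulP.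
Qed.
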